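(* Let $K\in\mathbb{R}$, $K_s>0$, $z_1\in\mathbb{C}$, and set $A:=K|z_1|/K_s$. Then the velocity field on $\mathbb{T}$ $$\tilde v_{z_1}(\theta)=-A\sin(\angle z_1-\theta)-\sin(2\theta)$$ has exactly two, three, or four zeros in $\mathbb{T}$.
   Context: $\mathbb{T}=\mathbb{R}/2\pi\mathbb{Z}$; $\angle z_1$ denotes the argument of $z_1=|z_1|e^{i\angle z_1}$ (arbitrary if $z_1=0$). Zeros are counted as distinct points, without multiplicity. *)

(* Defs.v *)
From HB Require Import structures.
From mathcomp Require Import all_boot all_order all_algebra.
From mathcomp Require Import all_classical all_reals all_analysis.
From mathcomp Require Import complex.
Set Implicit Arguments.
Unset Strict Implicit.
Unset Printing Implicit Defensive.
Import Order.TTheory GRing.Theory Num.Theory.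
Local Open Scope ring_scope.
Local Open Scope complex_scope.
Local Open Scope quotient_scope.

Definition twopiZ (R : realType) : {pred R} :=
  [pred x | `[< exists k : int, x = (pi *+ 2) *~ k >]].

Lemma twopiZ_zmod_closed (R : realType) : zmod_closed (@twopiZ R).
Proof.
split=> [|x y]; first by apply/asboolP; exists 0; rewrite mulr0z.
move=> /asboolP[k ->] /asboolP[l ->]; apply/asboolP; exists (k - l).
by rewrite mulrzBr.
Qed.

HB.instance Definition _ (R : realType) :=
  GRing.isZmodClosed.Build R (@twopiZ R) (@twopiZ_zmod_closed R).

Notation circle R := (Quotient.quot (@twopiZ R)).

(* sin and cos on the circle are computed on a representative; csin_pi and
   ccos_pi say that the choice is immaterial. *)
Definition csin (R : realType) (t : circle R) : R := sin (repr t).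
Definition ccos (R : realType) (t : circle R) : R := cos (repr t).

(* In these lemmas \pi is the projection onto the quotient, not the number. *)
Lemma repr_circle (R : realType) (x : R) :
  exists k : int, repr (\pi_(circle R) x) = x + (pi *+ 2) *~ k.
Proof.
have /eqP : \pi_(circle R) (repr (\pi_(circle R) x)) = \pi x by rewrite reprK.
rewrite eqmodE => /asboolP[k e]; exists k.
by rewrite -e addrC subrK.
Qed.

Lemma csin_pi (R : realType) (x : R) : csin (\pi_(circle R) x) = sin x.
Proof.
rewrite /csin; have [[n|n] ->] := repr_circle x.
  exact: (periodicn (@sinD2pi R)).
by rewrite -(periodicn (@sinD2pi R) n.+1) subrK.
Qed.

Lemma ccos_pi (R : realType) (x : R) : ccos (\pi_(circle R) x) = cos x.
Proof.
rewrite /ccos; have [[n|n] ->] := repr_circle x.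
  exact: (periodicn (@cosD2pi R)).
by rewrite -(periodicn (@cosD2pi R) n.+1) subrK.
Qed.

Notation modulus z := (ComplexField.Normc.normc z).

(* For z = 0 every phi is an argument. *)
Definition is_arg (R : realType) (z : R[i]) (phi : circle R) : Prop :=
  z = (modulus z)%:C * (ccos phi +i* csin phi).

Definition velocity (R : realType) (A : R) (phi theta : circle R) : R :=
  - A * csin (phi - theta) - csin (theta *+ 2).

(* Main.v *)
(** Upper bound: at z = exp(i theta) the velocity is, up to a nonvanishing
    factor, a quartic polynomial in z, and theta is determined by z.
    Lower bound: f(pi) = f(-pi) = - f(0) for the lift f of the velocity to the
    real line, so either f vanishes at 0 and at pi, or it changes sign on both
    ]-pi, 0[ and ]0, pi[. *)
Require Import Defs.
From mathcomp Require Import all_boot all_order all_algebra.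
From mathcomp Require Import all_classical all_reals all_analysis.
From mathcomp Require Import complex ring lra.
Import Order.TTheory GRing.Theory Num.Theory.
Import numFieldNormedType.Exports.
Local Open Scope classical_set_scope.
Local Open Scope card_scope.
Local Open Scope ring_scope.
Local Open Scope complex_scope.

(** An infinite [Z] would contain [n.+1] distinct points, against the bound on [r]. Once [Z] is
    finite, its enumeration is itself such an [r], and it contains [s]. *)
Lemma card_eq_between (T : choiceType) (Z : set T) (s : seq T) (n : nat) :
    uniq s -> [set` s] `<=` Z ->
    (forall r : seq T, uniq r -> [set` r] `<=` Z -> (size r <= n)%N) ->
  exists2 m : nat, Z #= `I_m & (size s <= m <= n)%N.
Proof.
move=> s_uniq sZ Zn.
have finZ : finite_set Z.
  apply: contrapT => /(infinite_set_fset n.+1)[B BZ].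
  by rewrite ltnNge Zn // finmap.fset_uniq.
have [m Zm] := (finite_setP Z).1 finZ; exists m => //.
rewrite -(card_fset_set Zm); apply/andP; split.
  by apply: uniq_leq_size => // x /sZ Zx; rewrite in_fset_set // inE.
apply: Zn => [|x /=]; first exact: finmap.fset_uniq.
by rewrite in_fset_set // inE.
Qed.

Section Circle.
Context {R : realType}.
Implicit Types (x A : R) (t u : circle R).

Lemma circle_pi_repr t : \pi_(circle R)%qT (repr t) = t.
Proof. exact: reprK. Qed.

Lemma circle_piB x y :
  \pi_(circle R)%qT (x - y) = \pi_(circle R)%qT x - \pi_(circle R)%qT y.
Proof. exact: raddfB. Qed.

Lemma circle_piMn x n : \pi_(circle R)%qT (x *+ n) = \pi_(circle R)%qT x *+ n.
Proof. exact: raddfMn. Qed.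

Lemma circle_pi_eq x y :
  (\pi_(circle R)%qT x = \pi_(circle R)%qT y) <-> (x - y \in @twopiZ R).
Proof.
split=> [/eqP|H]; first by rewrite eqmodE.
by apply/eqP; rewrite eqmodE.
Qed.

Lemma csinB t u : csin (t - u) = csin t * ccos u - ccos t * csin u.
Proof.
by rewrite -(circle_pi_repr t) -(circle_pi_repr u) -circle_piB !csin_pi !ccos_pi
   sinB.
Qed.

Lemma ccosB t u : ccos (t - u) = ccos t * ccos u + csin t * csin u.
Proof.
by rewrite -(circle_pi_repr t) -(circle_pi_repr u) -circle_piB !csin_pi !ccos_pi
   cosB.
Qed.

Lemma csin_mulr2n t : csin (t *+ 2) = ccos t * csin t *+ 2.
Proof.
by rewrite -(circle_pi_repr t) -circle_piMn !csin_pi !ccos_pi sin_mulr2n.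
Qed.

Lemma ccos2Dcsin2 t : ccos t ^+ 2 + csin t ^+ 2 = 1.
Proof. exact: cos2Dsin2. Qed.

(** Reduce [x] modulo the period to [r] in [0, 2 pi[. If [r] were nonzero, [r / 2] would lie in ]0,
    pi[, where the sine is positive, contradicting cos r = 1 - 2 sin(r/2)^2. *)
Lemma cos_eq1 x : cos x = 1 -> x \in @twopiZ R.
Proof.
move=> cosx; have pi2_gt0 : 0 < (pi : R) *+ 2 by rewrite mulrn_wgt0 ?pi_gt0.
pose k := Num.floor (x / (pi *+ 2)); pose r := x - (pi *+ 2) *~ k.
have r_x : \pi_(circle R)%qT r = \pi_(circle R)%qT x.
  apply/circle_pi_eq; apply/asboolP; exists (- k).
  by rewrite /r mulrNz addrC addKr.
have cosr : cos r = 1 by rewrite -ccos_pi r_x ccos_pi.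
have /andP[] := floor_itv (x / (pi *+ 2)); rewrite -/k.
rewrite ler_pdivlMr // ltr_pdivrMr // intrD mulrDl mul1r mulrzl => r_ge0 r_lt.
have [r0|r_neq0] := eqVneq r 0.
  apply/asboolP; exists k.
  by move/eqP: r0; rewrite subr_eq0 => /eqP.
have r_gt0 : 0 < r by rewrite lt_neqAle eq_sym r_neq0 subr_ge0.
have s_gt0 : 0 < sin (r / 2).
  apply: sin_gt0_pi; rewrite divr_gt0 //= ltr_pdivrMr // mulr_natr.
  by rewrite ltrBlDr addrC.
have : cos (r / 2 *+ 2) = 1 by rewrite -mulr_natr divfK.
rewrite cos_mulr2n => cos2.
have := cos2Dsin2 (r / 2).
nra.
Qed.

Definition expi t : R[i] := ccos t +i* csin t.

(** Equal sines and cosines turn the subtraction formula for [ccos (t - u)] into cos^2 + sin^2 = 1,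
    so [cos_eq1] applies to the difference of representatives. *)
Lemma expi_inj : injective expi.
Proof.
move=> t u [ct st]; rewrite -(circle_pi_repr t) -(circle_pi_repr u).
apply/circle_pi_eq/cos_eq1.
rewrite -ccos_pi circle_piB !circle_pi_repr ccosB ct st -!expr2.
exact: ccos2Dcsin2.
Qed.

Definition velocity_poly A t : {poly R[i]} :=
  'X^4 + - (A%:C * (expi t)^*) *: 'X^3 + (A%:C * expi t) *: 'X - 1.

Lemma size_velocity_poly A t : size (velocity_poly A t) = 5%N.
Proof.
rewrite /velocity_poly -!addrA size_polyDl size_polyXn //.
rewrite (leq_ltn_trans (size_polyD _ _)) // gtn_max.
rewrite (leq_ltn_trans (size_scale_leq _ _)) ?size_polyXn //=.
rewrite (leq_ltn_trans (size_polyD _ _)) // gtn_max.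
rewrite (leq_ltn_trans (size_scale_leq _ _)) ?size_polyX //=.
by rewrite size_polyN size_poly1.
Qed.

(* With z = expi u and w = expi t, both of modulus 1, the polynomial at z is
   z^2 times z^2 - 1/z^2 - A (z/w - w/z), which is -2i times the velocity. *)
Lemma root_velocity_poly A t u :
  velocity A t u = 0 -> root (velocity_poly A t) (expi u).
Proof.
rewrite /velocity csinB csin_mulr2n => v0.
have zz : expi u * (expi u)^* = 1.
  apply/eqP; rewrite eq_complex /= -(ccos2Dcsin2 u).
  apply/andP; split; apply/eqP; ring.
(* Conjugates stand for inverses here. The real part vanishes identically, and the imaginary part is
   -2 times the velocity. *)
have h : expi u ^+ 2 - (expi u)^* ^+ 2 - A%:C * (expi t)^* * expi u
         + A%:C * expi t * (expi u)^* = 0.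
  apply/eqP; rewrite eq_complex !expr2 /=.
  apply/andP; split; apply/eqP; first by ring.
  by rewrite -[RHS](mulr0 (- 2)) -v0; ring.
apply/rootP; rewrite /velocity_poly -polyC1.
rewrite !hornerD !hornerN !hornerZ !hornerXn hornerX hornerC.
(* The last two summands compensate for [ring] not knowing that [expi u] has modulus 1; both vanish
   by [zz]. *)
transitivity (expi u ^+ 2 * (expi u ^+ 2 - (expi u)^* ^+ 2
      - A%:C * (expi t)^* * expi u + A%:C * expi t * (expi u)^*)
    + ((expi u * (expi u)^*) ^+ 2 - 1)
    - A%:C * expi t * expi u * (expi u * (expi u)^* - 1)); first by ring.
by rewrite h zz; ring.
Qed.

Lemma velocity_zeros_le4 A t (r : seq (circle R)) :
  uniq r -> [set` r] `<=` [set u | velocity A t u = 0] -> (size r <= 4)%N.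
Proof.
(* [max_poly_roots] bounds the number of roots strictly by the size, which is the degree 4 plus
   one. *)
move=> r_uniq rZ; rewrite -(size_map expi) -ltnS -(size_velocity_poly A t).
apply: max_poly_roots; first by rewrite -size_poly_gt0 size_velocity_poly.
  by apply/allP => _ /mapP[u /rZ uZ ->]; exact: root_velocity_poly.
by rewrite map_inj_uniq //; exact: expi_inj.
Qed.

Lemma velocity_pi A x y :
  velocity A (\pi_(circle R)%qT x) (\pi_(circle R)%qT y) =
  - A * sin (x - y) - sin (y *+ 2).
Proof. by rewrite /velocity -circle_piB -circle_piMn !csin_pi. Qed.

Lemma continuous_velocity A x :
  continuous (fun y => - A * sin (x - y) - sin (y *+ 2)).
Proof.
move=> y; apply: cvgB; last first.
  apply: (@continuous_comp _ _ _ (fun y : R => y *+ 2) sin).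
    by apply: cvgD; exact: cvg_id.
  exact: continuous_sin.
apply: cvgMr; apply: (@continuous_comp _ _ _ (fun y : R => x - y) sin).
  by apply: cvgB; [exact: cvg_cst|exact: cvg_id].
exact: continuous_sin.
Qed.

Lemma velocity_zeros_ge2 A t :
  exists u v, [/\ u != v, velocity A t u = 0 & velocity A t v = 0].
Proof.
have := velocity_pi A (repr t); rewrite circle_pi_repr.
set x := repr t => vE.
pose f y := - A * sin (x - y) - sin (y *+ 2).
have f0 : f 0 = - A * sin x by rewrite /f mul0rn sin0 !subr0.
have fpi : f pi = A * sin x.
  by rewrite /f sin_mulr2n sinpi mulr0 mul0rn subr0 sinB sinpi cospi; ring.
have fNpi : f (- pi) = A * sin x.
  rewrite /f mulNrn sinN sin_mulr2n sinpi mulr0 mul0rn opprK.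
  by rewrite sinD sinpi cospi; ring.
have pi0 := pi_gt0 R.
have [b0|b_neq0] := eqVneq (A * sin x) 0.
  exists (\pi_(circle R)%qT 0), (\pi_(circle R)%qT pi); split.
  - apply/eqP => /(congr1 (@ccos R)); rewrite !ccos_pi cos0 cospi; lra.
  - by rewrite vE -/(f 0) f0 mulNr b0 oppr0.
  - by rewrite vE -/(f pi) fpi b0.
have fc a b : {within `[a, b], continuous f}.
  by apply: continuous_subspaceT; exact: continuous_velocity.
(* The endpoint values are opposite on both intervals, so the hypothesis of [IVT] holds whatever the
   sign of [A * sin x]. *)
have zero_between (b : R) : Num.min b (- b) <= 0 <= Num.max b (- b).
  rewrite ge_min le_max oppr_le0 oppr_ge0.
  by case: (leP b 0) => [_|/ltW ->]; rewrite ?orbT.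
have [|c] := @IVT _ f 0 pi 0 (ltW pi0) (fc _ _).
  by rewrite f0 fpi minC maxC mulNr.
rewrite in_itv /= => /andP[c_ge0 c_le] fcz.
have [||d] := @IVT _ f (- pi) 0 0 _ (fc _ _).
- by rewrite oppr_le0 ltW.
- by rewrite f0 fNpi mulNr.
rewrite in_itv /= => /andP[d_ge d_le0] fdz.
(* [IVT] only places [c] and [d] in closed intervals; since [f] is nonzero at the endpoints, they
   are interior. *)
have nz y : f y = 0 -> [/\ y != 0, y != pi & y != - pi].
  by move=> fy; split; apply/eqP => yE; move: fy; rewrite yE ?f0 ?fpi ?fNpi ?mulNr;
     apply/eqP; rewrite ?oppr_eq0.
have [c0 cpi _] := nz _ fcz; have [d0 _ dNpi] := nz _ fdz.
exists (\pi_(circle R)%qT c), (\pi_(circle R)%qT d); split; rewrite ?vE //.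
(* The sine separates the two zeros on the circle: it is positive at [c] and negative at [d]. *)
apply/eqP => /(congr1 (@csin R)); rewrite !csin_pi.
have : 0 < sin c by apply: sin_gt0_pi; rewrite !lt_neqAle eq_sym c0 c_ge0 cpi.
have : 0 < sin (- d).
  apply: sin_gt0_pi; rewrite oppr_gt0 ltrNl !lt_neqAle d0 d_le0 d_ge.
  by rewrite eq_sym dNpi.
rewrite sinN; lra.
Qed.

End Circle.

Theorem lemma4p2 (R : realType) (K Ks : R) (z1 : R[i]) (arg_z1 : circle R)
    (Ks_gt0 : 0 < Ks) (arg_z1P : is_arg z1 arg_z1) :
  let A := K * modulus z1 / Ks in
  let zeros := [set theta : circle R | velocity A arg_z1 theta = 0] in
  zeros #= `I_2 \/ zeros #= `I_3 \/ zeros #= `I_4.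
Proof.
move=> A zeros; have [u [v [uv u0 v0]]] := velocity_zeros_ge2 A arg_z1.
have [|w|m Zm /andP[]] :=
    @card_eq_between _ zeros [:: u; v] 4 _ _ (velocity_zeros_le4 A arg_z1).
- by rewrite /= inE uv.
- by rewrite /= !inE => /orP[] /eqP ->.
(* The bounds 2 and 4 on [m] compute to false outside the three remaining cases. *)
by case: m Zm => [|[|[|[|[|m]]]]] //= Zm _ _; [left|right; left|right; right].
Qed.
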